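(* For all non-negative integers $r_0, r_1$, not both zero, and each real $R> 0$, the following holds. Suppose that $\mathcal{H}$ is a non-empty $(r_0, r_1)$-bounded hypergraph on $V=V_0\cup V_1$ (with $V_0,V_1$ disjoint finite sets), and $b,m,q$ are positive integers with $b\leq \min\{m,|V_1|\}$, satisfying \[\Delta_{(\ell_0,\ell_1)}(\mathcal{H})\leq R \frac{b^{\ell_0+\ell_1-1}}{m^{\ell_0}|V_1|^{\ell_1}}e(\mathcal{H})\left(\frac{m}{q}\right)^{{1}[\ell_0>0]}\] for every pair $(\ell_0,\ell_1)\in \{0,1,\ldots,r_0\}\times\{0,1,\ldots,r_1\}\setminus \{(0,0)\}$. Then there exist a family $\mathcal{S}\subset \binom{V_0}{\leq r_0b}\times\binom{V_1}{\leq r_1b}$ and functions $f\colon \mathcal{S}\to 2^{V_0}\times 2^{V_1}$ and $g\colon \mathcal{F}_{\leq m}(\mathcal{H})\to \mathcal{S}$ such that, letting $\delta=2^{-(r_0+r_1+1)(r_0+r_1)}R^{-1}$: (i) if $(I,J)\in\mathcal{F}_{\leq m}(\mathcal{H})$ and $f(g(I,J))=(A,B)$, then $A\subset I$ and $J\subset B$; (ii) for every $(A,B)\in f(\mathcal{S})$, either $|A|\geq \delta q$ or $|B|\leq (1-\delta)|V_1|$; (iii) if $g(I,J)=(S_0,S_1)$ and $f(g(I,J))=(A,B)$, then $S_0\subset V_0\setminus I$ and $S_1\subset J$, and $|S_0|>0$ only if $|A|\geq \delta q$.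
   Context: Given disjoint finite sets $V_0,V_1$, an $(r_0,r_1)$-bounded hypergraph $\mathcal{H}$ on $V=V_0\cup V_1$ is a set of edges $E(\mathcal{H})\subset \binom{V_0}{\leq r_0}\times \binom{V_1}{\leq r_1}$; $e(\mathcal{H})=|E(\mathcal{H})|$. A pair $(W_0,W_1)\in 2^{V_0}\times 2^{V_1}$ violates an edge $(e_0,e_1)$ if $e_0\subset V_0\setminus W_0$ and $e_1\subset W_1$; it is independent if it violates no edge. $\mathcal{F}_{\leq m}(\mathcal{H})$ is the family of independent pairs $(W_0,W_1)$ with $|W_0|\leq m$. For $L_0\subset V_0$, $L_1\subset V_1$, the codegree $d_{(L_0,L_1)}(\mathcal{H})$ is the number of edges $(e_0,e_1)$ with $L_0\subset e_0$ and $L_1\subset e_1$, and $\Delta_{(\ell_0,\ell_1)}(\mathcal{H})=\max\{d_{(L_0,L_1)}(\mathcal{H}): |L_0|=\ell_0,|L_1|=\ell_1\}$. $1[\ell_0>0]$ is $1$ if $\ell_0>0$ and $0$ otherwise. $\binom{X}{\le k}$ denotes the family of subsets of $X$ of size at most $k$. *)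

(* Defs.v *)
From HB Require Import structures.
From mathcomp Require Import all_boot all_order all_algebra.
Set Implicit Arguments. Unset Strict Implicit. Unset Printing Implicit Defensive.
Import Order.TTheory GRing.Theory Num.Theory.

(* V0 and V1 are the (disjoint) finite types T0 and T1.
   A pair (W0,W1) in 2^V0 x 2^V1 is an element of {set T0} * {set T1};
   an edge (e0,e1) is also such a pair; a hypergraph is a finite set of edges. *)
Section Hyp.
Variables (T0 T1 : finType).
Notation pairT := ({set T0} * {set T1})%type.

Definition bounded_hyp (r0 r1 : nat) (H : {set pairT}) : Prop :=
  forall e, e \in H -> (#|e.1| <= r0)%N /\ (#|e.2| <= r1)%N.

Definition violates (W e : pairT) : bool :=
  (e.1 \subset ~: W.1) && (e.2 \subset W.2).

Definition independent (H : {set pairT}) (W : pairT) : bool :=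
  [forall e in H, ~~ violates W e].

Definition Fle (H : {set pairT}) (m : nat) : {set pairT} :=
  [set W | independent H W & (#|W.1| <= m)%N].

Definition codeg (H : {set pairT}) (L : pairT) : nat :=
  #|[set e in H | (L.1 \subset e.1) && (L.2 \subset e.2)]|.

(* maximum codegree Delta_{(l0,l1)}(H) (0 if there is no such (L0,L1)) *)
Definition maxcodeg (H : {set pairT}) (l0 l1 : nat) : nat :=
  \max_(L : pairT | (#|L.1| == l0) && (#|L.2| == l1)) codeg H L.

End Hyp.

(* Main.v *)
Require Import Defs.
From HB Require Import structures.
From mathcomp Require Import all_boot all_order all_algebra.
From mathcomp Require Import ring lra zify.
Set Implicit Arguments. Unset Strict Implicit. Unset Printing Implicit Defensive.
Import Order.TTheory GRing.Theory Num.Theory.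
Local Open Scope ring_scope.

(* Work on the disjoint union V of V_0 and V_1 and encode (I, J) as K = (V_0 \ I) + J, so that an
   edge e is violated iff e is contained in K. Starting from H, one repeatedly passes to a weighted
   hypergraph whose edges have one vertex fewer, r_1 times by deleting vertices of V_1 and then r_0
   times by deleting vertices of V_0. In each phase, the vertex u of largest degree is queried: if u
   is in K, then u joins the fingerprint and its link joins the new hypergraph; otherwise u is
   rejected. Sets whose degree in the new hypergraph is too large are frozen. If few vertices are
   rejected, then the new hypergraph has large total weight and satisfies the same codegree bounds
   with a worse constant. No pair can be independent in a hypergraph consisting of empty edges, so
   some phase rejects many vertices; the rejected vertices give the container. The run is
   determined by the set of queried vertices of K, which is the fingerprint. In a V_0-phase all
   edges lie in V_0, hence meet I, and |I| <= m bounds the largest degree from below; this is why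
   V_1 comes first. *)

(** * Weighted hypergraphs: degrees and union bounds *)

Section Weights.
Variables (F : realFieldType) (V : finType).
Implicit Types (w : {set V} -> F) (L e : {set V}).

Definition deg w L : F := \sum_(e : {set V} | L \subset e) w e.
Definition tot w : F := \sum_e w e.

Lemma sum_le_subpred (I : finType) (P Q : pred I) (G : I -> F) :
  (forall i, 0 <= G i) -> (forall i, P i -> Q i) ->
  \sum_(i | P i) G i <= \sum_(i | Q i) G i.
Proof.
move=> G0 PQ; rewrite (big_mkcond P) (big_mkcond Q) /=; apply: ler_sum => i _.
by case: ifP => [/PQ ->|_] //; case: ifP.
Qed.

Lemma sum_le_predU (I : finType) (P Q S : pred I) (G : I -> F) :
  (forall i, 0 <= G i) -> (forall i, P i -> Q i || S i) ->
  \sum_(i | P i) G i <= \sum_(i | Q i) G i + \sum_(i | S i) G i.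
Proof.
move=> G0 PQ; rewrite (big_mkcond P) (big_mkcond Q) (big_mkcond S) -big_split /=.
apply: ler_sum => i _; case: ifP => [/PQ|_].
  by move: (G0 i); do 2![case: ifP => _] => //=; lra.
by move: (G0 i); do 2![case: ifP => _] => //=; lra.
Qed.

Lemma sum_le_cover (I J : finType) (P : pred I) (Q : pred J)
    (r : J -> I -> bool) (G : I -> F) :
  (forall i, 0 <= G i) -> (forall i, P i -> exists2 j, Q j & r j i) ->
  \sum_(i | P i) G i <= \sum_(j | Q j) \sum_(i | r j i) G i.
Proof.
move=> G0 PQ.
rewrite (exchange_big_dep xpredT) //= (big_mkcond P) /=; apply: ler_sum => i _.
have S0 (R : pred J) : 0 <= \sum_(j | R j) G i by apply: sumr_ge0.
case: ifP => [/PQ[j Qj rj]|_] //.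
by rewrite (bigD1 j) /= ?Qj // lerDl.
Qed.

Lemma deg_ge0 w L : (forall e, 0 <= w e) -> 0 <= deg w L.
Proof. by move=> w0; apply: sumr_ge0. Qed.

Lemma degD w w' L : deg (fun e => w e + w' e) L = deg w L + deg w' L.
Proof. by rewrite /deg big_split. Qed.

Lemma totD w w' : tot (fun e => w e + w' e) = tot w + tot w'.
Proof. by rewrite /tot big_split. Qed.

(** Double counting: an edge with at most [s] vertices has at most [2 ^ s - 1] nonempty subsets.
    This bounds the weight lost to saturated sets. *)
Lemma sum_deg_le w (s : nat) : (forall e, 0 <= w e) ->
  (forall e, w e != 0 -> (#|e| <= s)%N) ->
  \sum_(L : {set V} | L != set0) deg w L <= (2%:R ^+ s - 1) * tot w.
Proof.
move=> w0 ws; rewrite /deg (exchange_big_dep xpredT) //= /tot mulr_sumr.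
apply: ler_sum => e _; rewrite sumr_const -[_ *+ _]mulr_natl.
have [->|we] := eqVneq (w e) 0; first by rewrite !mulr0.
apply: ler_wpM2r => //.
have -> : #|[pred L : {set V} | (L != set0) && (L \subset e)]| = (2 ^ #|e|).-1.
  rewrite -card_powerset (cardsD1 set0) inE sub0set /=.
  rewrite -cardsE; apply: eq_card => L.
  by rewrite !inE.
rewrite -subn1 natrB ?expn_gt0 // natrX lerD2r.
by rewrite ler_eXn2l ?ws // ltr1n.
Qed.

End Weights.

(** * A single phase of the algorithm *)

Section Scythe.
Variables (F : realFieldType) (V : finType).
Variables (w : {set V} -> F) (U : {set V}) (D : {set V} -> F) (b : nat) (N : F).

(* [sel]: queried vertices found in K; [rej]: queried vertices found outside K;
   [lnk]: the hypergraph under construction. *)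
Record state := State { sel : {set V}; rej : {set V}; lnk : {set V} -> F }.
Implicit Types (x : state) (K L e : {set V}) (u : V).

Definition saturated x L := (L != set0) && (D L < deg (lnk x) L).

Definition open_edge x e := [&& e :&: U != set0, [disjoint e & rej x] &
  [forall L : {set V}, (L \subset e) ==> ~~ saturated x L]].

(** Avoiding [sel x] ensures that each edge enters at most one link. *)
Definition live x e := open_edge x e && [disjoint e & sel x].

Definition ldeg x u := \sum_(e : {set V} | live x e && (u \in e)) w e.

Definition best x :=
  [pick u in U | (0 < ldeg x u) && [forall v in U, ldeg x v <= ldeg x u]].

(** The sum has at most one term, the one of the edge [u |: e]. *)
Definition link x u e := \sum_(e' : {set V} | live x e' && (u \in e') && (e' :\ u == e)) w e'.

Definition query K x u :=
  if u \in K then State (u |: sel x) (rej x) (fun e => lnk x e + link x u e)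
  else State (sel x) (u |: rej x) (lnk x).

Fixpoint loop n K x :=
  if n is n'.+1 then
    if (#|sel x| < b)%N then
      if best x is Some u then loop n' K (query K x u) else x
    else x
  else x.

(* Edges avoiding [U] are kept, scaled by the factor [b / N] by which the total weight of the links
   may drop. *)
Definition missed e := if [disjoint e & U] then w e else 0.
Definition init := State set0 set0 (fun e => b%:R / N * missed e).
Definition scythe K := loop #|V| K init.

Lemma sel_query K x u : sel x \subset sel (query K x u).
Proof. by rewrite /query; case: ifP => _ //=; rewrite subsetUr. Qed.

Lemma sel_loop n K x : sel x \subset sel (loop n K x).
Proof.
elim: n x => //= n IH x; case: ifP => // _; case: (best x) => // u.
exact: subset_trans (sel_query K x u) (IH _).
Qed.

(** Every query gets the same answer: a queried vertex of [K] ends up in the final [sel], hence in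
    [K'], and one outside [K] is outside [K']. *)
Lemma loop_stable n K K' x :
  sel (loop n K x) \subset K' -> K' \subset K -> loop n K' x = loop n K x.
Proof.
move=> + K'K; elim: n x => //= n IH x; case: ifP => // _.
case: (best x) => // u sK'; rewrite -IH //.
suff -> : query K' x u = query K x u by [].
rewrite /query; case: ifP => [/(subsetP K'K) -> //|uK'].
case: ifP => // uK; move/negP: uK'; case; apply: (subsetP sK').
apply: (subsetP (sel_loop _ _ _)).
by rewrite /query uK /= setU11.
Qed.

Lemma scythe_stable K K' :
  sel (scythe K) \subset K' -> K' \subset K -> scythe K' = scythe K.
Proof. exact: loop_stable. Qed.

Lemma loop_ind (P : state -> Prop) n K x :
  (forall x u, P x -> (#|sel x| < b)%N -> best x = Some u -> P (query K x u)) ->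
  P x -> P (loop n K x).
Proof.
move=> Pq; elim: n x => //= n IH x Px; case: ifP => // sb.
by case E: (best x) => [u|] //; apply: IH; apply: Pq.
Qed.

Hypothesis w0 : forall e, 0 <= w e.
Hypothesis b0 : (0 < b)%N.
Hypothesis bN : b%:R <= N.

Let bF : 0 < b%:R :> F. Proof. by rewrite ltr0n. Qed.
Let NF : 0 < N. Proof. exact: lt_le_trans bF bN. Qed.

Lemma ldeg_gt0 x u : 0 < ldeg x u -> u \notin sel x :|: rej x.
Proof.
move=> du; apply/negP => ux; move: du; rewrite /ldeg big1 ?ltxx // => e.
case/andP=> /andP[/and3P[_ er _] es] ue; move: ux; rewrite inE.
by rewrite (disjointFr er ue) (disjointFr es ue).
Qed.

Lemma bestP x u : best x = Some u ->
  [/\ u \in U, 0 < ldeg x u & forall v, v \in U -> ldeg x v <= ldeg x u].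
Proof.
rewrite /best; case: pickP => // v /and3P[vU v0 /forallP vm] [<-].
by split=> // v' v'U; move: (vm v'); rewrite v'U.
Qed.

Definition stopped x := ~~ (#|sel x| < b)%N \/ best x = None.

(** Each query settles a fresh vertex by [ldeg_gt0], so fuel for the unsettled vertices is
    enough. *)
Lemma loop_stopped n K x : (#|V| <= n + #|sel x :|: rej x|)%N -> stopped (loop n K x).
Proof.
elim: n x => /= [|n IH] x hn.
  right; case E: (best x) => [u|] //.
  have [_ /ldeg_gt0 + _] := bestP E.
  have -> : sel x :|: rej x = setT.
    by apply/eqP; rewrite eqEcard subsetT cardsT.
  by rewrite inE.
case: ifPn => [_|]; last by left.
case E: (best x) => [u|]; last by right.
have [_ /ldeg_gt0 ux _] := bestP E.
apply: IH; apply: leq_trans hn _; rewrite addSnnS leq_add2l.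
have -> : sel (query K x u) :|: rej (query K x u) = u |: (sel x :|: rej x).
  by rewrite /query; case: ifP => _ /=; [rewrite setUA | rewrite setUCA].
by rewrite cardsU1 ux.
Qed.

Lemma scythe_stopped K : stopped (scythe K).
Proof. by apply: loop_stopped; rewrite leq_addr. Qed.

Lemma link_ge0 x u e : 0 <= link x u e. Proof. exact: sumr_ge0. Qed.

Lemma deg_link x u L :
  deg (link x u) L = \sum_(e : {set V} | live x e && (u \in e) && (L \subset e :\ u)) w e.
Proof.
rewrite /deg /link.
rewrite [RHS](partition_big (fun e => e :\ u) (fun e => L \subset e)) /=; last first.
  by move=> e /andP[].
apply: eq_bigr => e Le; apply: eq_bigl => e'.
by case: eqP => [->|_]; rewrite ?Le ?andbT ?andbF.
Qed.

Lemma tot_link x u : tot (link x u) = ldeg x u.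
Proof.
have -> : tot (link x u) = deg (link x u) set0.
  by apply: eq_bigl => e; rewrite sub0set.
by rewrite deg_link; apply: eq_bigl => e; rewrite sub0set andbT.
Qed.

(* Each added link contributes at most [D L] to the degree of [L], and nothing once [L] is
   saturated. *)
Lemma deg_lnk_le K L :
  (forall L, L != set0 -> b%:R * deg w L <= N * D L) ->
  (forall u L, u \in U -> u \notin L -> L != set0 -> deg w (u |: L) <= D L) ->
  (forall L, 0 <= D L) ->
  L != set0 -> deg (lnk (scythe K)) L <= 2%:R * D L.
Proof.
move=> hD hDu D0 L0; rewrite /scythe.
apply: (loop_ind (P := fun x => deg (lnk x) L <= 2%:R * D L)) => [x u IH _ E|/=].
  have [uU _ _] := bestP E.
  rewrite /query; case: ifP => // uK /=; rewrite degD deg_link.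
  have [sL|sL] := boolP (saturated x L).
    rewrite [X in _ + X]big1 ?addr0 // => e /andP[/andP[/andP[/and3P[_ _ /forallP/(_ L)]]]].
    rewrite sL /= implybF => /negP eL _ _ Le.
    by case: eL; apply: subset_trans Le (subD1set _ _).
  move: sL; rewrite /saturated L0 /= -leNgt => dL.
  suff: \sum_(e : {set V} | live x e && (u \in e) && (L \subset e :\ u)) w e <= D L by lra.
  have [uL|uL] := boolP (u \in L).
    rewrite big1 // => e /andP[_ /subsetP/(_ u uL)]; by rewrite !inE eqxx.
  apply: le_trans (hDu u L uU uL L0); apply: sum_le_subpred => // e.
  case/andP=> /andP[_ ue]; rewrite subsetD1 => /andP[Le _].
  by rewrite subUset sub1set ue.
suff: deg (fun e => b%:R / N * missed e) L <= D L by move: (D0 L); lra.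
apply: le_trans (_ : b%:R / N * deg w L <= _).
  rewrite /deg mulr_sumr; apply: ler_sum => e _.
  apply: ler_wpM2l; first by rewrite divr_ge0 // ltW.
  by rewrite /missed; case: ifP.
by rewrite mulrAC ler_pdivrMr // [D L * N]mulrC hD.
Qed.

Lemma lnk_ge0 K e : 0 <= lnk (scythe K) e.
Proof.
apply: (loop_ind (P := fun x => 0 <= lnk x e)) => [x u IH _ _|/=].
  by rewrite /query; case: ifP => //= _; rewrite addr_ge0 ?link_ge0.
apply: mulr_ge0; first by rewrite divr_ge0 // ltW.
by rewrite /missed; case: ifP.
Qed.

Lemma sel_sub K : sel (scythe K) \subset K :&: U.
Proof.
apply: (loop_ind (P := fun x => sel x \subset K :&: U)) => [x u IH _ E|/=]; last exact: sub0set.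
have [uU _ _] := bestP E.
by rewrite /query; case: ifP => //= uK; rewrite subUset IH sub1set inE uK uU.
Qed.

Lemma rej_sub K : rej (scythe K) \subset U :\: K.
Proof.
apply: (loop_ind (P := fun x => rej x \subset U :\: K)) => [x u IH _ E|/=]; last exact: sub0set.
have [uU _ _] := bestP E.
by rewrite /query; case: ifP => //= uK; rewrite subUset IH sub1set inE uK uU.
Qed.

Lemma card_sel K : (#|sel (scythe K)| <= b)%N.
Proof.
apply: (loop_ind (P := fun x => (#|sel x| <= b)%N)) => [x u IH sb _|/=]; last by rewrite cards0.
rewrite /query; case: ifP => //= _; apply: leq_trans sb.
by rewrite cardsU1 -add1n leq_add2r leq_b1.
Qed.

(** Edge sizes and independence pass to the new hypergraph through this description of its edges. *)
Lemma lnk_supp K e : lnk (scythe K) e != 0 ->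
  (w e != 0 /\ [disjoint e & U]) \/
  exists u, [/\ u \in K, u \in U, u \notin e & w (u |: e) != 0].
Proof.
apply: (loop_ind (P := fun x => lnk x e != 0 -> _)) => [x u IH _ E|/=]; last first.
  rewrite /missed; case: ifP => [eU|_]; last by rewrite mulr0 eqxx.
  by rewrite mulf_eq0 negb_or => /andP[_ we]; left.
have [uU _ _] := bestP E.
rewrite /query; case: ifP => //= uK.
have [->|/IH //] := eqVneq (lnk x e) 0; rewrite add0r => le; right; exists u.
case: (pickP (fun e' : {set V} => (u \in e') && (e' :\ u == e) && (w e' != 0))) => [e'|h].
  case/andP=> /andP[ue' /eqP <-] we'; rewrite setD1K //; split=> //.
  by rewrite !inE eqxx.
case/eqP: le; rewrite /link big1 // => e' /andP[/andP[_ ue'] De'].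
by apply/eqP; move: (h e'); rewrite ue' De' /= => /negbFE.
Qed.

Definition live_tot x := \sum_(e : {set V} | live x e) w e.
Definition blocked x := \sum_(e : {set V} | open_edge x e && ~~ [disjoint e & sel x]) w e.
(** The total weight of the links added so far. *)
Definition gain x := tot (lnk x) - b%:R / N * tot missed.

Lemma open_query K x u e : open_edge (query K x u) e -> open_edge x e.
Proof.
case/and3P=> eU er /forallP hs; apply/and3P; split=> //.
  by move: er; rewrite /query; case: ifP => //= _ er; apply: disjointWr (subsetUr _ _) er.
apply/forallP=> L; apply/implyP=> Le; move/implyP/(_ Le): (hs L); apply: contra.
rewrite /saturated; case/andP=> -> /= h; apply: lt_le_trans h _.
rewrite /query; case: ifP => //= _; rewrite degD lerDl deg_ge0 // => e'; exact: link_ge0.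
Qed.

Lemma live_query K x u e : live (query K x u) e -> live x e.
Proof.
case/andP=> /open_query oe ds; rewrite /live oe /=.
exact: disjointWr (sel_query K x u) ds.
Qed.

(** * Progress of a phase when a small set hits every edge that meets [U] *)

Section Hitting.
Variable Z : {set V}.
Hypothesis ZN : #|Z|%:R <= N.
Hypothesis hitZ : forall e, w e != 0 -> e :&: U != set0 -> e :&: (Z :&: U) != set0.

Lemma live_tot_le_sum x : live_tot x <= \sum_(u in Z :&: U) ldeg x u.
Proof.
apply: le_trans (_ : \sum_(e : {set V} | live x e && (w e != 0)) w e <= _).
  rewrite /live_tot [leLHS](bigID (fun e : {set V} => w e != 0)) /= [X in _ + X]big1 ?addr0 //.
  by move=> e /andP[_]; rewrite negbK => /eqP.
apply: (sum_le_cover (r := fun u e => live x e && (u \in e))) => // e /andP[le we].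
have /and3P[eU _ _] : open_edge x e by case/andP: le.
have /set0Pn[u] := hitZ we eU; rewrite inE => /andP[ue uZ].
by exists u => //; rewrite le.
Qed.

(** Averaging: at most [N] vertices meet all live edges of nonzero weight. *)
Lemma live_tot_best x u : best x = Some u -> live_tot x <= N * ldeg x u.
Proof.
move=> E; have [_ /ltW d0 dm] := bestP E.
apply: le_trans (live_tot_le_sum x) _.
apply: le_trans (_ : \sum_(v in Z :&: U) ldeg x u <= _).
  by apply: ler_sum => v; rewrite inE => /andP[_ /dm].
rewrite sumr_const -[_ *+ _]mulr_natl; apply: ler_wpM2r => //.
apply: le_trans ZN; rewrite ler_nat; exact: subset_leq_card (subsetIl _ _).
Qed.

Lemma live_tot_None x : best x = None -> live_tot x <= 0.
Proof.
move=> E; apply: le_trans (live_tot_le_sum x) _.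
apply: sumr_le0 => v; rewrite inE => /andP[_ vU].
rewrite leNgt; apply/negP => dv.
case: (arg_maxP (ldeg x) vU) => u uU um; have {}uU : u \in U := uU.
move: E; rewrite /best; case: pickP => // /(_ u)/negP []; rewrite uU /=.
apply/andP; split; first by apply: lt_le_trans dv (um _ vU).
by apply/forallP => v'; apply/implyP => /um.
Qed.

(** Loop invariant. A query in [K] gains [ldeg x u], at least [live_tot x / N] by averaging, while
    [live_tot] never grows. The edges newly blocked by [u] were live, so [ldeg x u] also pays for
    them. *)
Lemma scythe_account K (x := scythe K) :
  #|sel x|%:R * live_tot x <= N * gain x /\ blocked x <= gain x.
Proof.
apply: (loop_ind (P := fun x => #|sel x|%:R * live_tot x <= N * gain x /\ blocked x <= gain x));
  last first.
  have g0 : gain init = 0 by rewrite /gain /= {1}/tot -mulr_sumr subrr.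
  rewrite g0 mulr0 /= cards0 mul0r; split=> //; rewrite /blocked big1 // => e.
  by rewrite /= -setI_eq0 setI0 eqxx andbF.
move=> {}x u [h1 h2] sb E; have lu := live_tot_best E.
have lm : live_tot (query K x u) <= live_tot x.
  by apply: sum_le_subpred => // e; exact: live_query.
have l0 : 0 <= live_tot (query K x u) by apply: sumr_ge0.
have [uK|uK] := boolP (u \in K).
  have gE : gain (query K x u) = gain x + ldeg x u.
    by rewrite /gain {1}/query uK /= totD tot_link addrAC.
  rewrite gE; split.
    rewrite mulrDr; apply: le_trans (lerD h1 lu).
    rewrite -[X in _ <= _ + X]mul1r -mulrDl; apply: ler_pM => //.
    by rewrite /query uK /= natr1 ler_nat cardsU1 -add1n leq_add2r leq_b1.
  apply: le_trans (lerD h2 (lexx _)).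
  apply: sum_le_predU => // e /andP[/open_query oe].
  rewrite oe {1}/query uK /= /live oe /=.
  rewrite -setI_eq0 setIUr setU_eq0 !setI_eq0 [X in X && _]disjoint_sym disjoints1.
  by case: [disjoint e & sel x] => //=; rewrite andbT negbK.
have gE : gain (query K x u) = gain x.
  by rewrite /gain {1}/query (negbTE uK).
have sE : sel (query K x u) = sel x by rewrite /query (negbTE uK).
rewrite gE sE; split; first by apply: le_trans h1; rewrite ler_wpM2l.
apply: le_trans h2; apply: sum_le_subpred => // e /andP[/open_query ->].
by rewrite sE.
Qed.

(** Every edge misses [U], is live, is blocked, meets [rej x] or contains a saturated set; each
    class is charged to the rejected vertices or to the new total weight. *)
Lemma scythe_tot K (d : F) (s : nat) (x := scythe K) :
  (forall L, L != set0 -> b%:R * deg w L <= N * D L) ->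
  (forall u, u \in U -> deg w [set u] <= d) ->
  (forall e, lnk x e != 0 -> (#|e| <= s)%N) ->
  tot w <= #|rej x|%:R * d + N / b%:R * (2%:R ^+ s + 1) * tot (lnk x).
Proof.
move=> hD hd hs; have [h1 h2] := scythe_account K; rewrite -/x in h1 h2.
have xge := lnk_ge0 K.
set kap := N / b%:R; have kap0 : 0 <= kap by rewrite divr_ge0 // ltW.
have kap1 : 1 <= kap by rewrite ler_pdivlMr // mul1r.
(* Either [b] vertices were selected and the invariant applies, or the loop stopped because no live
   weight was left. *)
have liveb : live_tot x <= kap * gain x.
  have g0 : 0 <= gain x by apply: le_trans h2; apply: sumr_ge0.
  case: (scythe_stopped K) => [|/live_tot_None E]; last by apply: le_trans E _; rewrite mulr_ge0.
  rewrite -leqNgt => bs; rewrite /kap mulrAC ler_pdivlMr // mulrC.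
  by apply: le_trans h1; rewrite ler_wpM2r ?ler_nat //; apply: sumr_ge0.
have part1 : tot w <= tot missed + (live_tot x + blocked x) +
    \sum_(u in rej x) deg w [set u] + \sum_(L : {set V} | saturated x L) deg w L.
  have -> : live_tot x + blocked x = \sum_(e : {set V} | open_edge x e) w e.
    by rewrite [RHS](bigID (fun e : {set V} => [disjoint e & sel x])).
  have -> : tot missed = \sum_(e : {set V} | [disjoint e & U]) w e.
    by rewrite [RHS]big_mkcond.
  pose hr (e : {set V}) := ~~ [disjoint e & rej x].
  pose hL (e : {set V}) := [exists L : {set V}, (L \subset e) && saturated x L].
  have b1 : \sum_(e : {set V} | hr e) w e <= \sum_(u in rej x) deg w [set u].
    apply: (sum_le_cover (r := fun u e => [set u] \subset e)) => // e.
    by case/pred0Pn=> u /andP[ue ur]; exists u => //; rewrite sub1set.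
  have b2 : \sum_(e : {set V} | hL e) w e <= \sum_(L : {set V} | saturated x L) deg w L.
    apply: (sum_le_cover (r := fun L e => L \subset e)) => // e.
    by case/existsP=> L /andP[Le sL]; exists L.
  apply: le_trans (lerD (lerD (lexx _) b1) b2).
  apply: le_trans (_ : _ <= \sum_(e : {set V} | [disjoint e & U] || open_edge x e || hr e) w e
      + \sum_(e | hL e) w e) _.
    apply: sum_le_predU => // e _.
    rewrite /open_edge -[e :&: U != set0]/(~~ (e :&: U == set0)) setI_eq0 /hr /hL.
    case: [disjoint e & U] => //=; case: [disjoint e & rej x] => //=; rewrite ?orbT //.
    case: (boolP [forall L : {set V}, (L \subset e) ==> ~~ saturated x L]) => //=.
    rewrite negb_forall => /existsP[L]; rewrite negb_imply negbK => sL.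
    by apply/existsP; exists L.
  rewrite lerD2r.
  apply: le_trans (_ : _ <= \sum_(e : {set V} | [disjoint e & U] || open_edge x e) w e
      + \sum_(e | hr e) w e) _.
    exact: sum_le_predU.
  rewrite lerD2r; exact: sum_le_predU.
have rejd : \sum_(u in rej x) deg w [set u] <= #|rej x|%:R * d.
  rewrite mulr_natl -sumr_const; apply: ler_sum => u ur; apply: hd.
  by have /subsetP/(_ u ur) := rej_sub K; rewrite inE => /andP[].
(* For saturated [L], combine [b * deg w L <= N * D L] with [D L < deg (lnk x) L]. *)
have satd : \sum_(L : {set V} | saturated x L) deg w L <= kap * ((2%:R ^+ s - 1) * tot (lnk x)).
  apply: le_trans (_ : _ <= kap * \sum_(L : {set V} | L != set0) deg (lnk x) L) _; last first.
    by apply: ler_wpM2l => //; exact: sum_deg_le.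
  apply: le_trans (_ : _ <= kap * \sum_(L : {set V} | saturated x L) deg (lnk x) L) _; last first.
    apply: ler_wpM2l => //; apply: sum_le_subpred => [L|L /andP[] //]; exact: deg_ge0.
  rewrite mulr_sumr; apply: ler_sum => L /andP[L0 /ltW DL].
  rewrite /kap mulrAC ler_pdivlMr // mulrC; apply: le_trans (hD L L0) _.
  by rewrite ler_pM2l.
(* Missed edges cost [kap * (tot (lnk x) - gain x)] and live ones [kap * gain x], so [gain x]
   cancels; blocked ones cost one more [kap * tot (lnk x)]. This makes [2 ^ s - 1 + 1 + 1]. *)
have misE : tot missed = kap * (tot (lnk x) - gain x).
  by rewrite /gain /kap; field; rewrite !gt_eqF.
have gl : gain x <= kap * tot (lnk x).
  have t0 : 0 <= tot missed by apply: sumr_ge0 => e _; rewrite /missed; case: ifP.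
  have k2 : 0 <= b%:R / N * tot missed by rewrite mulr_ge0 // divr_ge0 // ltW.
  have xt0 : 0 <= tot (lnk x) by apply: sumr_ge0.
  apply: le_trans (_ : tot (lnk x) <= _); first by rewrite /gain lerBlDr lerDl.
  by rewrite ler_peMl.
rewrite misE in part1.
have -> : kap * (2 ^+ s + 1) * tot (lnk x) =
    kap * ((2 ^+ s - 1) * tot (lnk x)) + kap * tot (lnk x) + kap * tot (lnk x) by ring.
rewrite mulrBr in part1; lra.
Qed.

End Hitting.
End Scythe.

(** * The sequence of phases and the codegree bounds along it *)

Section Phases.
Variables (F : realFieldType) (T0 T1 : finType) (b m q : nat) (delta : F).
Notation V := (T0 + T1)%type.
Implicit Types (w : {set V} -> F) (K L e : {set V}) (c : bool) (ps : seq bool).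

(* [side true] is V_1 and [side false] is V_0. *)
Definition side c : {set V} := [set v | (if v is inr _ then true else false) == c].
(* In a phase on side [c], some [cap c] vertices meet all edges that meet the side, and the
   algorithm ends once [delta * thr c] vertices are rejected. *)
Definition cap c := if c then #|T1| else m.
Definition thr c := if c then #|T1| else q.

(** The right-hand side of the codegree hypothesis at the sizes of the two parts of [L], without [R]
    and [e(H)]. *)
Definition beta L : F :=
  b%:R ^+ #|L|.-1 / (m%:R ^+ #|L :&: side false| * #|T1|%:R ^+ #|L :&: side true|)
  * (if (0 < #|L :&: side false|)%N then m%:R / q%:R else 1).

(* With [i] phases remaining, [(cst i)^-1] plays the role of [R]; it is exactly [R] at the start,
   where [i = r0 + r1]. *)
Definition cst i : F := delta * 2%:R ^+ (i * i.+1).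

(** The current degree bound, scaled by [b / cap c], the factor by which the total weight may drop
    up to a constant. *)
Definition degcap c i w L : F := b%:R / (cap c)%:R * (beta L * tot w / cst i).

Definition phase c i w K := scythe w (side c) (degcap c i w) b (cap c)%:R K.

(* [ps] lists the sides of the remaining phases. *)
Fixpoint run ps K w : {set V} * {set V} :=
  if ps is c :: ps' then
    let x := phase c (size ps) w K in
    if delta * (thr c)%:R <= #|rej x|%:R then (sel x, rej x)
    else let y := run ps' K (lnk x) in (sel x :|: y.1, y.2)
  else (set0, set0).

Lemma run_stable ps K K' w :
  (run ps K w).1 \subset K' -> K' \subset K -> run ps K' w = run ps K w.
Proof.
move=> + K'K; elim: ps w => //= c ps IH w h.
have sK' : sel (phase c (size ps).+1 w K) \subset K'.
  by move: h; case: ifP => //= _; rewrite subUset => /andP[].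
have E : phase c (size ps).+1 w K' = phase c (size ps).+1 w K by apply: scythe_stable.
rewrite E; move: h; case: ifP => //= _; rewrite subUset => /andP[_ h].
by rewrite IH.
Qed.

Lemma card_sides L : (#|L| = #|L :&: side true| + #|L :&: side false|)%N.
Proof.
rewrite -(cardsID (side true) L); congr addn; apply: eq_card => v.
by rewrite !inE andbC; case: v.
Qed.

Lemma card_side_U1 c c' u L : u \in side c -> u \notin L ->
  #|(u |: L) :&: side c'| = ((c == c') + #|L :&: side c'|)%N.
Proof.
rewrite inE => /eqP uc uL; have [<-|cc'] := eqVneq c c'.
  rewrite (_ : _ :&: _ = u |: (L :&: side c)) ?cardsU1 ?inE ?(negbTE uL) //.
  by apply/setP=> v; rewrite !inE; case: eqVneq => [->|_] //=; rewrite uc eqxx.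
apply: eq_card => v; rewrite !inE; case: eqVneq => [->|_] //=.
by rewrite uc (negbTE cc') andbF.
Qed.

Lemma card_side_set1 c c' u : u \in side c -> #|[set u] :&: side c'| = (c == c').
Proof.
move=> uc; rewrite -[[set u]]setU0 (@card_side_U1 c c' u set0 uc) ?in_set0 //.
by rewrite set0I cards0 addn0.
Qed.

Hypotheses (b0 : (0 < b)%N) (m0 : (0 < m)%N) (q0 : (0 < q)%N).
Hypotheses (bm : (b <= m)%N) (bT : (b <= #|T1|)%N) (delta0 : 0 < delta).

Let T1_gt0 : (0 < #|T1|)%N. Proof. exact: leq_trans bT. Qed.
Let bF : 0 < b%:R :> F. Proof. by rewrite ltr0n. Qed.
Let mF : 0 < m%:R :> F. Proof. by rewrite ltr0n. Qed.
Let qF : 0 < q%:R :> F. Proof. by rewrite ltr0n. Qed.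
Let TF : 0 < #|T1|%:R :> F. Proof. by rewrite ltr0n. Qed.
Let capF c : 0 < (cap c)%:R :> F. Proof. by case: c. Qed.
Let thrF c : 0 < (thr c)%:R :> F. Proof. by case: c. Qed.

Lemma cst_gt0 i : 0 < cst i.
Proof. by rewrite mulr_gt0 // exprn_gt0. Qed.

Lemma beta_ge0 L : 0 <= beta L.
Proof.
rewrite /beta mulr_ge0 //; last by case: ifP => // _; rewrite divr_ge0 ?ler0n.
by rewrite divr_ge0 ?mulr_ge0 ?exprn_ge0 ?ler0n.
Qed.

(** The first vertex of V_0 would also bring in the factor [m / q]; the last condition excludes that
    case. *)
Lemma beta_U1 c u L : u \in side c -> u \notin L -> L != set0 ->
  c || (0 < #|L :&: side false|)%N -> beta (u |: L) = b%:R / (cap c)%:R * beta L.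
Proof.
move=> uc uL L0 cL; rewrite /beta !(card_side_U1 _ uc uL) cardsU1 uL /=.
have -> : #|L| = #|L|.-1.+1 by rewrite prednK // card_gt0.
rewrite /= exprS.
case: c uc cL => uc /= cL; rewrite ?eqxx /= ?add0n ?add1n.
  rewrite exprS; set t := (if _ then _ else _); field.
  by rewrite !expf_neq0 ?gt_eqF.
rewrite cL /= exprS; field.
by rewrite !expf_neq0 ?gt_eqF.
Qed.

(** The origin of [thr]: in a stage a vertex has degree at most [tot w / (cst i * thr c)], so few
    rejected vertices carry little weight. *)
Lemma beta_set1 c u : u \in side c -> beta [set u] = (thr c)%:R^-1.
Proof.
move=> uc; rewrite /beta !(card_side_set1 _ uc) cards1.
case: c uc => uc /=; rewrite !expr0 ?expr1 ?mul1r ?mulr1 //.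
by field; rewrite !gt_eqF.
Qed.

(** The invariant between phases. The remaining phases on a side bound the edge sizes there, so with
    none left all edges are empty. *)
Record stage ps w : Prop := Stage {
  stage_ge0 : forall e, 0 <= w e;
  stage_tot : 0 < tot w;
  stage_size : forall c e, w e != 0 -> (#|e :&: side c| <= count_mem c ps)%N;
  stage_deg : forall L, (0 < size ps)%N -> L != set0 ->
    cst (size ps) * deg w L <= beta L * tot w }.

(** * One phase preserves the invariant unless it rejects many vertices *)

Section Step.
Variables (c : bool) (ps : seq bool) (w : {set V} -> F) (K : {set V}).
Hypothesis cps : all (fun c' => c' ==> c) ps.
Hypothesis st : stage (c :: ps) w.
Hypothesis indep : forall e, w e != 0 -> ~~ (e \subset K).
Hypothesis Km : (#|side false :\: K| <= m)%N.

Let x := phase c (size ps).+1 w K.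
Let w0 := stage_ge0 st.
Let bcap : b%:R <= (cap c)%:R :> F. Proof. by rewrite ler_nat; case: (c). Qed.

Let no_true (ce : c = false) e : w e != 0 -> #|e :&: side true| = 0%N.
Proof.
move=> we; apply/eqP; rewrite -leqn0; apply: leq_trans (stage_size st true we) _.
rewrite ce /= add0n leqn0 eqn0Ngt -has_count -all_predC.
by apply: sub_all cps => c' /=; rewrite ce implybF; case: c'.
Qed.

(** A new edge either misses side [c] or has lost a vertex of it. *)
Lemma lnk_side c' e : lnk x e != 0 -> (#|e :&: side c'| <= count_mem c' ps)%N.
Proof.
case/lnk_supp => [[we eU]|[u [_ uc ue we]]]; have := stage_size st c' we => /=.
  have [<- _|//] := eqVneq c c'.
  by move: eU; rewrite -setI_eq0 => /eqP ->; rewrite cards0.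
by rewrite (card_side_U1 _ uc ue) leq_add2l.
Qed.

Lemma lnk_indep e : lnk x e != 0 -> ~~ (e \subset K).
Proof.
case/lnk_supp => [[we _]|[u [uK _ _ /indep]]]; first exact: indep.
by rewrite subUset sub1set uK.
Qed.

(** The rejected vertices carry at most half of the weight, which costs one factor 2; another comes
    from [2 ^ s + 1 <= 2 ^ s.+1]. *)
Lemma phase_tot : #|rej x|%:R < delta * (thr c)%:R ->
  tot w <= 2%:R ^+ (size ps).+2 * ((cap c)%:R / b%:R * tot (lnk x)).
Proof.
move=> hr; set s := size ps.
(* The hitting set: V_1 itself, or [I] in a V_0-phase, where an edge lies in V_0 and is not
   contained in [K]. *)
pose Z := if c then side true else side false :\: K.
have ZN : #|Z|%:R <= (cap c)%:R :> F.
  rewrite ler_nat /Z; case: (c) => //=.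
  rewrite (_ : side true = [set inr y | y in T1]); last first.
    apply/setP=> -[y|y]; rewrite inE /=; last by rewrite imset_f.
    by apply/esym/negbTE/imsetP; case.
  exact: leq_imset_card.
have hitZ e : w e != 0 -> e :&: side c != set0 -> e :&: (Z :&: side c) != set0.
  move=> we; rewrite /Z; case E: c => //; first by rewrite setIid.
  move=> _; have /subsetPn[v ve vK] := indep we; apply/set0Pn; exists v.
  rewrite !inE ve vK /= andbb; apply/negP => vt.
  have /eqP := no_true E we; rewrite cards_eq0 => /eqP/setP/(_ v).
  rewrite !inE ve /=; by case: (v) vt.
have hs e : lnk x e != 0 -> (#|e| <= s)%N.
  move=> le; rewrite card_sides.
  apply: leq_trans (leq_add (lnk_side true le) (lnk_side false le)) _.
  by rewrite /s -(count_predC (pred1 true) ps) leq_add2l; apply: sub_count => -[].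
have hD L : L != set0 -> b%:R * deg w L <= (cap c)%:R * degcap c s.+1 w L.
  move=> L0; rewrite /degcap; rewrite mulrA [_ * (b%:R / _)]mulrC divfK ?gt_eqF //.
  rewrite ler_pM2l // ler_pdivlMr ?cst_gt0 // mulrC.
  exact: (stage_deg st).
have ct0 : 0 < cst s.+1 * (thr c)%:R by apply: mulr_gt0 => //; exact: cst_gt0.
have hd u : u \in side c -> deg w [set u] <= tot w / (cst s.+1 * (thr c)%:R).
  move=> uc; rewrite ler_pdivlMr // mulrA -ler_pdivlMr //.
  rewrite mulrC [tot w / _]mulrC -(beta_set1 uc); apply: (stage_deg st) => //.
  by rewrite -card_gt0 cards1.
have := scythe_tot w0 b0 bcap ZN hitZ hD hd hs.
rewrite -[scythe _ _ _ _ _ _]/x; set X := tot (lnk x); set kap := (cap c)%:R / b%:R.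
have X0 : 0 <= kap * X.
  rewrite mulr_ge0 ?divr_ge0 ?ler0n //; apply: sumr_ge0 => e _; exact: lnk_ge0.
have t0 := stage_tot st.
(* The ratio [delta / cst s.+1] is [2 ^- (s.+1 * s.+2)], at most one half. *)
have : #|rej x|%:R * (tot w / (cst s.+1 * (thr c)%:R)) <= tot w / 2%:R.
  apply: le_trans (_ : delta * (thr c)%:R * (tot w / (cst s.+1 * (thr c)%:R)) <= _).
    by apply: ler_wpM2r (ltW hr); rewrite divr_ge0 ?(ltW ct0) ?(ltW t0).
  rewrite (_ : _ * _ = tot w / 2%:R ^+ (s.+1 * s.+2)); last first.
    by rewrite /cst; field; rewrite ?expf_neq0 ?gt_eqF.
  rewrite ler_pM2l // lef_pV2 ?qualifE //= ?exprn_gt0 //.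
  by rewrite -[leLHS]expr1 ler_eXn2l ?ltr1n // muln_gt0.
have : kap * (2 ^+ s + 1) * X <= 2 ^+ s.+1 * (kap * X).
  have p1 : 1 <= 2 ^+ s :> F by apply: exprn_ege1; rewrite ler1n.
  rewrite mulrAC mulrC; apply: ler_wpM2r => //; rewrite exprS.
  by move: p1; move: (2 ^+ s) => P; lra.
move=> h1 h2 h3; rewrite exprS -mulrA.
by move: h1 h2 h3; move: (2 ^+ s.+1 * _) (#|rej x|%:R * _) (kap * _ * _) => A B C; lra.
Qed.

(** The degree bound scales by [b / cap c] up to a factor 2, the total weight drops by at most that
    ratio up to [2 ^ s.+2], and passing from [cst s.+1] to [cst s] absorbs both constants. *)
Lemma stage_step : #|rej x|%:R < delta * (thr c)%:R -> stage ps (lnk x).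
Proof.
move=> hr; have ht := phase_tot hr; set s := size ps in ht.
have k0 : 0 < (cap c)%:R / b%:R :> F by rewrite divr_gt0.
split.
- by move=> e; apply: lnk_ge0.
- have := lt_le_trans (stage_tot st) ht.
  by rewrite pmulr_rgt0 ?exprn_gt0 // pmulr_rgt0.
- exact: lnk_side.
move=> L s0 L0.
have t0 := ltW (stage_tot st).
have degcap0 L' : 0 <= degcap c s.+1 w L'.
  apply: mulr_ge0; first by rewrite divr_ge0 ?ler0n.
  by rewrite divr_ge0 ?(ltW (cst_gt0 _)) //; exact: mulr_ge0 (beta_ge0 _) t0.
have degw L' : L' != set0 -> deg w L' <= beta L' * tot w / cst s.+1.
  by move=> ?; rewrite ler_pdivlMr ?cst_gt0 // mulrC; exact: (stage_deg st).
have dL : deg (lnk x) L <= 2%:R * degcap c s.+1 w L.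
  apply: deg_lnk_le => // {L0} [L' L0|u L' uc uL L0].
    rewrite /degcap; rewrite mulrA [_ * (b%:R / _)]mulrC divfK ?gt_eqF //.
    by rewrite ler_pM2l // degw.
  have [cL|] := boolP (c || (0 < #|L' :&: side false|)%N).
    apply: le_trans (degw _ _) _; first by rewrite setU_eq0 negb_and L0 orbT.
    by rewrite (beta_U1 uc uL L0 cL) /degcap !mulrA.
  (* Here [L'] is a nonempty subset of V_1 while all edges lie in V_0, so the degree is zero. *)
  rewrite negb_or -eqn0Ngt => /andP[/negbTE ce l0].
  rewrite /deg big1 // => e; rewrite subUset => /andP[_ Le].
  apply/eqP; apply: contraT => /(no_true ce) le.
  move: L0; rewrite -card_gt0 card_sides (eqP l0) addn0.
  by rewrite lt0n -leqn0 -le subset_leq_card // setSI.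
rewrite -ler_pdivlMl ?cst_gt0 //; apply: le_trans dL _.
rewrite /degcap -/s ler_pdivlMl ?cst_gt0 //.
(* This is [s + 3 <= 2 * (s + 1)], true only for [s >= 1]; hence [stage_deg] speaks only of stages
   with a phase left. *)
have hs : cst s * 2%:R ^+ s.+3 <= cst s.+1.
  rewrite /cst -mulrA -exprD ler_pM2l // ler_eXn2l ?ltr1n //.
  by rewrite -/s in s0; nia.
have h2 : cst s * (2 * 2 ^+ s.+2) / cst s.+1 <= 1.
  by rewrite -exprS ler_pdivrMr ?cst_gt0 // mul1r.
have hb : 0 <= beta L := beta_ge0 L.
set X := tot (lnk x) in ht *; set kap := (cap c)%:R / b%:R in ht k0.
have X0 : 0 <= X by apply: sumr_ge0 => e _; exact: lnk_ge0.
rewrite (_ : b%:R / (cap c)%:R = kap^-1); last by rewrite invf_div.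
apply: le_trans (_ : cst s * (2 * (kap^-1 * (beta L * (2 ^+ s.+2 * (kap * X)) / cst s.+1))) <= _).
  apply: ler_wpM2l; first exact/ltW/cst_gt0.
  apply: ler_wpM2l => //; apply: ler_wpM2l; first by rewrite invr_ge0 ltW.
  apply: ler_wpM2r; first by rewrite invr_ge0 ltW ?cst_gt0.
  exact: ler_wpM2l.
rewrite [leLHS](_ : _ = (cst s * (2 * 2 ^+ s.+2) / cst s.+1) * (beta L * X)).
  by rewrite ler_piMl // mulr_ge0.
by field; rewrite !gt_eqF ?cst_gt0.
Qed.

End Step.

(** The last clause serves (iii): V_1-phases come first, so a run ending in one has selected nothing
    in V_0. *)
Lemma run_correct ps w K : sorted (fun c c' => c' ==> c) ps -> stage ps w ->
  (forall e, w e != 0 -> ~~ (e \subset K)) -> (#|side false :\: K| <= m)%N ->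
  let y := run ps K w in
  [/\ y.1 \subset K, [disjoint y.2 & K],
      forall c, (#|y.1 :&: side c| <= count_mem c ps * b)%N &
      exists c, [/\ c \in ps, y.2 \subset side c,
        delta * (thr c)%:R <= #|y.2|%:R & c -> y.1 :&: side false = set0]].
Proof.
move=> srt st ind Km; elim: ps w srt st ind => [|c ps IH] w srt st ind /=.
  (* With no phases left, an edge of nonzero weight is empty, hence inside [K], against
     independence: this case is void. *)
  have [e we|h] := pickP (fun e => w e != 0); last first.
    have := stage_tot st; rewrite /tot big1 ?ltxx // => e _.
    by apply/eqP; move: (h e) => /negbFE.
  have := ind e we; rewrite (_ : e = set0) ?sub0set //; apply/eqP.
  rewrite -cards_eq0 -leqn0 card_sides.
  exact: leq_add (stage_size st true we) (stage_size st false we).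
have cps : all (fun c' => c' ==> c) ps.
  by apply: (order_path_min _ srt) => -[] [] [].
set x := phase c (size ps).+1 w K.
have selK : sel x \subset K :&: side c := sel_sub _ _ _ _ _ _.
have rejK : rej x \subset side c :\: K := rej_sub _ _ _ _ _ _.
have selb : (#|sel x| <= b)%N := card_sel _ _ _ _ _ _.
have sdis c1 c2 : c1 != c2 -> side c1 :&: side c2 = set0.
  move=> c12; apply/setP=> v; rewrite !inE; apply/negP => /andP[/eqP-> /eqP E].
  by rewrite E eqxx in c12.
have selc c' : (#|sel x :&: side c'| <= (c == c') * b)%N.
  have [<-|cc'] := eqVneq c c'.
    by rewrite mul1n; apply: leq_trans selb; rewrite subset_leq_card ?subsetIl.
  rewrite mul0n leqn0 cards_eq0 -subset0 -(sdis _ _ cc') setSI //.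
  exact: subset_trans selK (subsetIr _ _).
have selF : c -> sel x :&: side false = set0.
  move=> ct; apply/eqP; rewrite -cards_eq0 -leqn0; apply: leq_trans (selc _) _.
  by rewrite ct.
case: ifPn => [hr|]; last rewrite -ltNge => hr.
  split=> /=.
  - exact: subset_trans selK (subsetIl _ _).
  - by apply: disjointWl rejK _; rewrite -setI_eq0 setIDAC setDE -setIA setICr setI0.
  - by move=> c'; apply: leq_trans (selc c') _; rewrite leq_mul2r leq_addr orbT.
  exists c; split=> //; first by rewrite mem_head.
  exact: subset_trans rejK (subsetDl _ _).
have st' : stage ps (lnk x) by exact: stage_step.
have ind' e : lnk x e != 0 -> ~~ (e \subset K) by exact: lnk_indep.
have [/= h1 h2 h3 [c' [c'ps h4 h5 h6]]] := IH _ (path_sorted srt) st' ind'.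
split=> /=.
- by rewrite subUset h1 andbT; apply: subset_trans selK (subsetIl _ _).
- by [].
- move=> c1; rewrite setIUl; apply: leq_trans (leq_card_setU _ _) _.
  by rewrite mulnDl leq_add.
exists c'; split=> //; first by rewrite inE c'ps orbT.
move=> c't; rewrite setIUl h6 // setU0 selF //.
by have /allP/(_ _ c'ps) := cps; rewrite c't.
Qed.

End Phases.

(** * Translation between pairs of sets and subsets of the disjoint union *)

Section Join.
Variables (T0 T1 : finType).
Notation pairT := ({set T0} * {set T1})%type.
Implicit Types (P : pairT) (L : {set T0 + T1}).

Definition join P : {set T0 + T1} :=
  [set v | match v with inl a => a \in P.1 | inr a => a \in P.2 end].
Definition parts L : pairT := (inl @^-1: L, inr @^-1: L).

Lemma joinK : cancel join parts.
Proof. by case=> A B; congr pair; apply/setP=> a; rewrite !inE. Qed.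

Lemma partsK : cancel parts join.
Proof. by move=> L; apply/setP=> -[a|a]; rewrite !inE. Qed.

Lemma sub_join L P :
  (L \subset join P) = ((parts L).1 \subset P.1) && ((parts L).2 \subset P.2).
Proof.
apply/subsetP/andP => [h|[/subsetP h0 /subsetP h1] [a|a] aL].
- by split; apply/subsetP=> a; rewrite inE => /h; rewrite inE.
- by rewrite inE h0 // inE.
by rewrite inE h1 // inE.
Qed.

Lemma card_parts1 L : #|L :&: side T0 T1 false| = #|(parts L).1|.
Proof.
rewrite -(card_imset _ (@inl_inj T0 T1)); apply: eq_card => -[a|a]; rewrite !inE.
  by rewrite eqxx andbT mem_imset ?inE //; exact: inl_inj.
by rewrite andbF; apply/esym/negbTE/imsetP; case.
Qed.

Lemma card_parts2 L : #|L :&: side T0 T1 true| = #|(parts L).2|.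
Proof.
rewrite -(card_imset _ (@inr_inj T0 T1)); apply: eq_card => -[a|a]; rewrite !inE.
  by rewrite andbF; apply/esym/negbTE/imsetP; case.
by rewrite eqxx andbT mem_imset ?inE //; exact: inr_inj.
Qed.

(** Complementing the first component merges the two conditions into one inclusion. *)
Lemma violates_join P e :
  violates P e = (join e \subset join (~: P.1, P.2)).
Proof. by rewrite sub_join joinK. Qed.

Definition edge_weight (F : realFieldType) (H : {set pairT}) L : F := (parts L \in H)%:R.

Lemma deg_edge_weight (F : realFieldType) (H : {set pairT}) L :
  deg (edge_weight F H) L = (codeg H (parts L))%:R.
Proof.
rewrite /deg (reindex join) /=; last by exists parts => ? _; rewrite ?joinK ?partsK.
rewrite /codeg -sum1_card natr_sum big_mkcond [RHS]big_mkcond /=.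
apply: eq_bigr => P _; rewrite sub_join /edge_weight joinK inE.
by case: (P \in H) => //=; case: ifP.
Qed.

Lemma tot_edge_weight (F : realFieldType) (H : {set pairT}) :
  tot (edge_weight F H) = #|H|%:R.
Proof.
rewrite (_ : tot _ = deg (edge_weight F H) set0); last first.
  by apply: eq_bigl => e; rewrite sub0set.
rewrite deg_edge_weight; congr _%:R; apply: eq_card => P.
by rewrite !inE /= !preimset0 !sub0set !andbT.
Qed.

End Join.

(** * Assembly: initial stage, fingerprints and containers *)

Theorem theorem2p1 (F : archiRealFieldType) (r0 r1 : nat) (R : F)
    (T0 T1 : finType) (H : {set ({set T0} * {set T1})}) (b m q : nat) :
  (0 < r0 + r1)%N -> 0 < R ->
  H != set0 -> bounded_hyp r0 r1 H ->
  (0 < b)%N -> (0 < m)%N -> (0 < q)%N -> (b <= minn m #|T1|)%N ->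
  (forall l0 l1 : nat, (l0 <= r0)%N -> (l1 <= r1)%N -> (0 < l0 + l1)%N ->
     (maxcodeg H l0 l1)%:R <=
       R * (b%:R ^+ (l0 + l1 - 1)%N / (m%:R ^+ l0 * (#|T1|)%:R ^+ l1))
         * (#|H|)%:R * (if (0 < l0)%N then m%:R / q%:R else 1)) ->
  let delta : F := (2%:R ^+ ((r0 + r1 + 1) * (r0 + r1)))^-1 * R^-1 in
  exists (S : {set ({set T0} * {set T1})})
         (f g : ({set T0} * {set T1}) -> ({set T0} * {set T1})),
    [/\ (forall P, P \in S -> (#|P.1| <= r0 * b)%N /\ (#|P.2| <= r1 * b)%N),
        (forall W, W \in Fle H m -> g W \in S),
        (* (i) *)
        (forall W, W \in Fle H m ->
           (f (g W)).1 \subset W.1 /\ W.2 \subset (f (g W)).2),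
        (* (ii) *)
        (forall P, P \in S ->
           delta * q%:R <= (#|(f P).1|)%:R \/
           (#|(f P).2|)%:R <= (1 - delta) * (#|T1|)%:R) &
        (* (iii) *)
        (forall W, W \in Fle H m ->
           [/\ (g W).1 \subset ~: W.1, (g W).2 \subset W.2 &
               ((0 < #|(g W).1|)%N -> delta * q%:R <= (#|(f (g W)).1|)%:R)])].
Proof.
move=> r0r1 R0 H0 bH b0 m0 q0; rewrite leq_min => /andP[bm bT] hdeg delta.
have delta0 : 0 < delta by rewrite mulr_gt0 ?invr_gt0 ?exprn_gt0.
pose ps := nseq r1 true ++ nseq r0 false.
pose w := edge_weight F H.
pose key W : {set T0 + T1} := join (~: W.1, W.2).
pose go K := run b m q delta ps K w.
pose g W := parts (go (key W)).1.
(* The run is repeated on the fingerprint alone. Rejected vertices of V_0 form [A]; those of V_1 are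
   removed from V_1 to give [B]. *)
pose f P := let y := parts (go (join P)).2 in (y.1, ~: y.2).
have sps : size ps = (r0 + r1)%N by rewrite size_cat !size_nseq addnC.
have cps c : count_mem c ps = if c then r1 else r0.
  by rewrite count_cat !count_nseq; case: c => /=; lia.
have srt : sorted (fun c c' => c' ==> c) ps.
  rewrite /ps; elim: (r1) => [|[|k] IHk] //=.
    by elim: (r0) => [|[|k] IHk].
  by case: (r0) IHk.
have st : stage b m q delta ps w.
  split.
  - by move=> e; rewrite ler0n.
  - by rewrite tot_edge_weight ltr0n card_gt0.
  - move=> c e; rewrite pnatr_eq0 eqb0 negbK => /bH[h0 h1].
    by rewrite cps; case: c; rewrite ?card_parts1 ?card_parts2.
  move=> L _ L0; rewrite deg_edge_weight tot_edge_weight /cst sps.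
  have -> : delta * 2 ^+ ((r0 + r1) * (r0 + r1).+1) = R^-1.
    rewrite /delta mulrAC [((r0 + r1 + 1) * _)%N]mulnC addn1 mulVf ?mul1r //.
    by rewrite expf_neq0 // pnatr_eq0.
  rewrite ler_pdivrMl // /beta card_parts1 card_parts2.
  rewrite -card_gt0 (card_sides L) card_parts1 card_parts2 addnC in L0.
  have := card_sides L; rewrite card_parts1 card_parts2 addnC => ->.
  have [Lb|Lb] := boolP ((#|(parts L).1| <= r0)%N && (#|(parts L).2| <= r1)%N).
    case/andP: Lb => l0 l1; have := hdeg _ _ l0 l1 L0.
    rewrite -subn1 => h; apply: le_trans (_ : (maxcodeg H #|(parts L).1| #|(parts L).2|)%:R <= _).
      by rewrite ler_nat; rewrite /maxcodeg; apply: leq_bigmax_cond; rewrite !eqxx.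
    by apply: le_trans h _; rewrite -!mulrA [X in _ * (_ * (_ * X))]mulrC.
  (* Beyond the sizes [r0], [r1] the hypothesis is silent, but no edge contains such an [L]. *)
  have -> : codeg H (parts L) = 0%N.
    apply/eqP; rewrite cards_eq0 -subset0; apply/subsetP => e; rewrite !inE.
    case/andP=> /bH[h0 h1] /andP[/subset_leq_card s0 /subset_leq_card s1].
    by move: Lb; rewrite (leq_trans s0 h0) (leq_trans s1 h1).
  apply: mulr_ge0; first exact: ltW.
  rewrite mulr_ge0 ?ler0n // mulr_ge0 ?divr_ge0 ?mulr_ge0 ?exprn_ge0 ?ler0n //.
  by case: ifP => // _; rewrite divr_ge0 ?ler0n.
have ok W (y := go (key W)) : W \in Fle H m ->
  [/\ y.1 \subset key W, [disjoint y.2 & key W],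
      forall c, (#|y.1 :&: side T0 T1 c| <= count_mem c ps * b)%N &
      exists c, [/\ c \in ps, y.2 \subset side T0 T1 c,
        delta * (thr T1 q c)%:R <= #|y.2|%:R & c -> y.1 :&: side T0 T1 false = set0]].
  rewrite inE => /andP[/forallP indW Wm]; apply: run_correct => //.
    move=> e; rewrite pnatr_eq0 eqb0 negbK => eH.
    by have := indW (parts e); rewrite eH violates_join partsK.
  apply: leq_trans Wm; rewrite setDE setIC card_parts1.
  by apply/eq_leq/eq_card => a; rewrite !inE negbK.
have fg W : W \in Fle H m -> go (join (g W)) = go (key W).
  case/ok=> sK _ _ _; rewrite /g partsK; apply: run_stable => //.
exists (g @: Fle H m), f, g; split.
- move=> _ /imsetP[W /ok[_ _ hc _] ->]; split.
    by rewrite -card_parts1; have := hc false; rewrite cps.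
  by rewrite -card_parts2; have := hc true; rewrite cps.
- by move=> W hW; apply: imset_f.
(* Rejected vertices lie outside [key W]: those in V_0 belong to [I], those in V_1 avoid [J]. *)
- move=> W hW; rewrite /f fg //=; have [_ dis _ _] := ok W hW; split.
    apply/subsetP=> a; rewrite inE => /(disjointFr dis); rewrite inE /= inE.
    by move/negbFE.
  apply/subsetP=> a aW; rewrite !inE; apply/negP => /(disjointFr dis).
  by rewrite inE /= aW.
(* The side of the final phase decides between the two alternatives. *)
- move=> _ /imsetP[W hW ->]; rewrite /f fg //=; have [_ _ _ [c [_ sc hc _]]] := ok W hW.
  move: hc; rewrite -{1}(setIidPl sc); case: c {sc}; rewrite ?card_parts1 ?card_parts2 /= => h.
    right; have := cardsC (inr @^-1: (go (key W)).2); move/(congr1 (fun k => k%:R : F)).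
    rewrite natrD; lra.
  by left.
move=> W hW; have [sK _ _ [c [_ sc hc h0]]] := ok W hW.
have := sK; rewrite sub_join => /andP[s0 s1]; split=> //.
(* A run ending on V_1 has an empty [S_0]; one ending on V_0 has a large [A]. *)
rewrite /f fg // /g -card_parts1; case: c sc hc h0 => sc hc h0.
  by rewrite h0 // cards0.
by move=> _; rewrite /= -[#|_|](card_parts1 (go (key W)).2) (setIidPl sc).
Qed.
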